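(* Let $\mathfrak{b}$ be a Borel subalgebra of the complex simple Lie algebra of type $G_2$. For each integer $m\geq 0$ let $N(m)$ be the number of abelian ideals of $\mathfrak{b}$ of dimension $m$. Then $N(0)=N(1)=N(2)=N(3)=1$ and $N(m)=0$ for $m\geq 4$; the total number of abelian ideals of $\mathfrak{b}$ is $4$.
   Context: An abelian ideal of $\mathfrak{b}$ is an ideal $I$ of the Lie algebra $\mathfrak{b}$ with $[I,I]=0$ (the zero ideal is included); dimension is over $\mathbb{C}$. *)

(* Defs.v *)
From HB Require Import structures.
From mathcomp Require Import all_boot all_order all_algebra.
From mathcomp Require Import all_classical all_reals.
From mathcomp.real_closed Require Export complex.

Set Implicit Arguments.
Unset Strict Implicit.
Unset Printing Implicit Defensive.

Import Order.TTheory GRing.Theory Num.Theory.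
Local Open Scope ring_scope.

Section LieAlgebra.
Variables (F : fieldType) (L : vectType F).

(* A bilinear map L x L -> L is given in curried form: br x : 'End(L) is the
   adjoint map of x, and br x y is the bracket [x, y].                        *)
Variable br : 'Hom(L, 'End(L)).

Definition is_lie_bracket : Prop :=
  (forall x, br x x = 0) /\
  (forall x y z, br x (br y z) + br y (br z x) + br z (br x y) = 0).

Definition lie_abelian (U : {vspace L}) : Prop :=
  forall x y, x \in U -> y \in U -> br x y = 0.

Definition lie_ideal (b I : {vspace L}) : Prop :=
  (I <= b)%VS /\ (forall x y, x \in b -> y \in I -> br x y \in I).

Definition lie_simple : Prop :=
  ~ lie_abelian fullv /\
  (forall I, lie_ideal fullv I -> I = 0%VS \/ I = fullv).

Definition ad_diagonalizable (h : L) : Prop :=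
  exists2 X : seq L, basis_of fullv X &
    forall x, x \in X -> exists c : F, br h x = c *: x.

(* Cartan subalgebra of a semisimple Lie algebra over an algebraically closed
   field of characteristic 0: a maximal abelian subalgebra consisting of
   ad-semisimple elements (Helgason, Ch. III, section 3).  A subspace on which
   the bracket vanishes is automatically a subalgebra.                        *)
Definition cartan_subalgebra (H : {vspace L}) : Prop :=
  [/\ lie_abelian H,
      forall K, lie_abelian K -> (H <= K)%VS -> K = H
    & forall h, h \in H -> ad_diagonalizable h].

Section Roots.
Variable H : {vspace L}.

Notation dual := 'Hom(subvs_of H, F^o).

(* It is enough to impose the eigenvector condition on a basis of H:
   see mem_rootspace.                                                         *)
Definition rootspace (alpha : dual) : {vspace L} :=
  (\bigcap_(h <- vbasis {: subvs_of H})
      lker (br (vsval h) - (alpha h : F) *: \1%VF))%VS.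

Lemma mem_rootspace (alpha : dual) (x : L) :
  x \in rootspace alpha <->
  forall h : subvs_of H, br (vsval h) x = (alpha h : F) *: x.
Proof.
have kerE h : (x \in lker (br (vsval h) - (alpha h : F) *: \1%VF)) =
              (br (vsval h) x == (alpha h : F) *: x).
  by rewrite memv_ker add_lfunE opp_lfunE scale_lfunE id_lfunE subr_eq0.
have capE s : (x \in (\bigcap_(h <- s)
      lker (br (vsval h) - (alpha h : F) *: \1%VF))%VS) =
    all (fun h => br (vsval h) x == (alpha h : F) *: x) s.
  elim: s => [|h s IHs]; first by rewrite big_nil memvf.
  by rewrite big_cons memv_cap kerE IHs.
rewrite /rootspace capE; split=> [/allP xP h|xP]; last first.
  by apply/allP => h _; rewrite xP.
rewrite (coord_vbasis (memvf h)) !linear_sum /= sum_lfunE scaler_suml.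
apply: eq_bigr => i _; rewrite !linearZ /= lfunE /=.
rewrite (eqP (xP _ _)) ?scalerA //.
by rewrite -tnth_nth mem_tnth.
Qed.

Definition is_root (alpha : dual) : bool :=
  (alpha != 0) && (rootspace alpha != 0%VS).

(* The positive roots of the root system G2 on its base (a, b), with a short
   and b long, i.e., with Cartan integers <a, b^v> = -1 and <b, a^v> = -3.    *)
Definition G2_positive_roots (V : zmodType) (a b : V) : seq V :=
  [:: a; b; a + b; a *+ 2 + b; a *+ 3 + b; a *+ 3 + b *+ 2].

Definition root_system_of_type_G2 : Prop :=
  exists a b : dual, free [:: a; b] /\
    forall alpha : dual,
      is_root alpha = (alpha \in G2_positive_roots a b)
                      || (- alpha \in G2_positive_roots a b).

Definition positive_system (P : seq dual) : Prop :=
  [/\ {subset P <= is_root},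
      forall alpha, is_root alpha -> (alpha \in P) (+) (- alpha \in P)
    & forall alpha beta, alpha \in P -> beta \in P ->
        is_root (alpha + beta) -> alpha + beta \in P].

(* b is a Borel subalgebra of (L, H) in the sense of Bourbaki, Lie VIII,
   section 3, no. 3: H plus the root spaces of a system of positive roots.    *)
Definition borel_subalgebra (b : {vspace L}) : Prop :=
  exists2 P : seq dual, positive_system P &
    b = (H + \sum_(alpha <- P) rootspace alpha)%VS.

End Roots.

Definition abelian_ideals (b : {vspace L}) : set {vspace L} :=
  [set I : {vspace L} | lie_ideal b I /\ lie_abelian I]%classic.

Definition abelian_ideals_dim (b : {vspace L}) (m : nat) : set {vspace L} :=
  [set I : {vspace L} | abelian_ideals b I /\ \dim I = m]%classic.

End LieAlgebra.

(* Main.v *)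
Require Import Defs.
From HB Require Import structures.
From mathcomp Require Import all_boot all_order all_algebra.
From mathcomp Require Import all_classical all_reals.
From mathcomp.real_closed Require Import complex.
From mathcomp Require Import ring.

Set Implicit Arguments.
Unset Strict Implicit.
Unset Printing Implicit Defensive.

Import Order.TTheory GRing.Theory Num.Theory.
Local Open Scope ring_scope.
Local Open Scope card_scope.

(** Let Q be the set of positive roots defining the Borel subalgebra. An
    abelian ideal I of it is stable under H, so it is the sum of its
    intersections with H and with the root spaces ([rspace_components]). The
    intersection with H is 0, since a nonzero h in I and a root vector with
    nonzero eigenvalue would give a nonzero bracket inside I
    ([abelian_ideal_H]). Root spaces are lines ([rspace_line]), so I is the
    sum of the root spaces of a subset S of Q. Since the bracket of two root
    spaces is nonzero whenever the sum of the roots is a root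
    ([root_bracket_neq0]), I is an abelian ideal exactly when S absorbs the
    addition of elements of Q, inside the set of roots, and no two elements
    of S add up to a root. For G2 there is one such S of each size 0, 1, 2, 3
    and no other: with the base a, b (a short) they are the initial segments
    of 3a+2b, 3a+b, 2a+b. This is a finite enumeration, done for all closed
    choices of one root in each pair of opposite roots
    ([abelian_ideal_weights_size]); it takes the place of a Weyl group
    argument that brings Q into standard position.

    The two facts on root spaces come from the Killing form and from sl2. All
    roots are integral combinations of two independent functionals, hence
    each h in H has a conjugate k in H, at which every root takes the
    conjugate value, and tr (ad h ad k) is the sum of the squared moduli of
    the eigenvalues of ad h ([killing_conj]). So the Killing form is
    nondegenerate on H; in particular its radical, an ideal of the simple
    algebra, is 0. It follows that for each nonzero x of root p there is y of
    root -p such that p does not vanish at [x, y] ([opposite_root_vector]);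
    this yields a copy of sl2, and the lengths of its strings ([sl2_string])
    give the nonvanishing of brackets.

    Roots are written in coordinates on a base: a pair of integers (i, j)
    stands for the functional i a + j b, and H is the space of weight 0. *)

(** * Linear algebra *)

Lemma exists_lfun (F : fieldType) (U V : vectType F) (f : U -> V) :
  linear f -> exists g : 'Hom(U, V), forall x, g x = f x.
Proof.
move=> f_lin.
pose fL : {linear U -> V} := HB.pack f (GRing.isLinear.Build _ _ _ _ f f_lin).
by exists (linfun fL) => x; rewrite lfunE.
Qed.

Section Diagonalization.
Variables (F : fieldType) (L : vectType F).
Implicit Types (f g : 'End(L)) (U V : {vspace L}) (X : seq L).

Lemma free_subseq X :
  exists Y, [/\ {subset Y <= X}, free Y & <<Y>>%VS = <<X>>%VS].
Proof.
elim: X => [|x X [Y [sYX Yfree YX]]].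
  by exists [::]; split=> //; apply: nil_free.
have [xY|xNY] := boolP (x \in <<Y>>%VS).
  exists Y; split=> // [y /sYX yX|]; first by rewrite inE yX orbT.
  rewrite span_cons -YX; apply/esym/addv_idPr.
  by rewrite -memvE.
exists (x :: Y); split; last by rewrite !span_cons YX.
  by move=> y; rewrite !inE => /predU1P[->|/sYX->]; rewrite ?eqxx ?orbT.
by rewrite free_cons xNY.
Qed.

(** For the eigenvalue [c] of one component, [f - c] kills that component and
    rescales the others by nonzero factors, which allows an induction on their
    number. *)
Lemma eigen_components (I : eqType) f U (s : seq I) (c : I -> F) (v : I -> L) :
    (forall u, u \in U -> f u \in U) -> uniq (map c s) ->
    (forall i, i \in s -> f (v i) = c i *: v i) -> \sum_(i <- s) v i \in U ->
  forall i, i \in s -> v i \in U.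
Proof.
move=> fU; elim: s v => [|i0 s IH] v //= /andP[ci0 uc] fv.
have fv0 := fv i0 (mem_head i0 s).
have fvs i : i \in s -> f (v i) = c i *: v i.
  by move=> si; rewrite fv // inE si orbT.
rewrite big_cons => vU.
have vsU i : i \in s -> v i \in U.
  move=> si; have nz : c i - c i0 != 0.
    by rewrite subr_eq0; apply: contraNneq ci0 => <-; rewrite map_f.
  have/(_ i si) : forall j, j \in s -> (c j - c i0) *: v j \in U.
    apply: (IH (fun j => (c j - c i0) *: v j)) => // [j sj|].
      by rewrite linearZ /= fvs // !scalerA mulrC.
    have -> : \sum_(j <- s) (c j - c i0) *: v j =
        f (v i0 + \sum_(j <- s) v j) - c i0 *: (v i0 + \sum_(j <- s) v j).
      rewrite linearD linear_sum /= fv0 scalerDr opprD addrACA subrr add0r.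
      rewrite scaler_sumr -sumrB big_seq [RHS]big_seq.
      by apply: eq_bigr => j sj; rewrite fvs // scalerBl.
    by rewrite memvB ?fU ?memvZ.
  by move=> wU; rewrite -(scale1r (v i)) -(mulVf nz) -scalerA memvZ.
move=> i; rewrite inE => /predU1P[->|/vsU//].
rewrite -(addrK (\sum_(j <- s) v j) (v i0)) memvB //.
by rewrite big_seq; apply: memv_suml.
Qed.

Lemma eigen_decomposition f X :
    <<X>>%VS = fullv -> (forall x, x \in X -> exists c, f x = c *: x) ->
  exists2 C : seq F, uniq C & forall x, exists2 v : F -> L,
    x = \sum_(c <- C) v c & forall c, f (v c) = c *: v c.
Proof.
move=> Xfull Xeig.
have /fin_all_exists[lam lamP] : forall i : 'I_(size X), exists c,
    f X`_i = c *: X`_i by move=> i; apply: Xeig; rewrite mem_nth.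
exists (undup (codom lam)) => [|x]; first exact: undup_uniq.
have := memvf x; rewrite -Xfull => /(@coord_span _ _ _ (in_tuple X)) xE.
pose k i := coord (in_tuple X) i x.
exists (fun c => \sum_(i < size X | c == lam i) k i *: X`_i).
  rewrite {1}xE (exchange_big_dep predT) //=; apply: eq_bigr => i _.
  rewrite -big_filter filter_pred1_uniq ?undup_uniq ?mem_undup ?codom_f //.
  by rewrite big_seq1.
move=> c; rewrite linear_sum scaler_sumr; apply: eq_bigr => i /eqP->.
by rewrite linearZ /= lamP !scalerA mulrC.
Qed.

Definition joint_eigenvector (s : seq 'End(L)) (y : L) :=
  forall f, f \in s -> exists c, f y = c *: y.

(** Commuting diagonalizable endomorphisms are diagonalizable simultaneously:
    the components of a joint eigenvector along the eigenspaces of a further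
    endomorphism are joint eigenvectors, since the eigenspaces of the
    previous ones are stable. *)
Lemma joint_eigenvectors_span (s : seq 'End(L)) :
    (forall f, f \in s -> exists2 X : seq L, <<X>>%VS = fullv &
       forall x, x \in X -> exists c, f x = c *: x) ->
    (forall f g, f \in s -> g \in s -> forall x, f (g x) = g (f x)) ->
  exists2 X : seq L, <<X>>%VS = fullv &
    forall x, x \in X -> joint_eigenvector s x.
Proof.
elim: s => [|f s IH] sdiag scomm.
  by exists (vbasis fullv); rewrite ?(span_basis (vbasisP _)).
have [||X Xfull XP] := IH.
- by move=> g gs; apply: sdiag; rewrite inE gs orbT.
- by move=> g h gs hs; apply: scomm; rewrite inE ?gs ?hs orbT.
have [Xf Xf_full Xf_eig] := sdiag f (mem_head f s).
have [C uC Cdec] := eigen_decomposition Xf_full Xf_eig.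
suffices [Z ZP XZ] : exists2 Z : seq L,
    (forall z, z \in Z -> joint_eigenvector (f :: s) z) &
    (<<X>> <= <<Z>>)%VS.
  by exists Z => //; apply/eqP; rewrite eqEsubv subvf -Xfull.
elim: X XP {Xfull} => [|x X IHX] XP.
  by exists [::]; rewrite ?subvv.
have [|Z ZP XZ] := IHX.
  by move=> y yX; apply: XP; rewrite inE yX orbT.
have [v xE vP] := Cdec x.
exists (map v C ++ Z); last first.
  rewrite span_cons span_cat subv_add; apply/andP; split; last first.
    exact: subv_trans XZ (addvSr _ _).
  apply: subv_trans (addvSl _ _); rewrite -memvE xE big_seq.
  by apply: memv_suml => c cC; rewrite memv_span ?map_f.
move=> z; rewrite mem_cat => /orP[/mapP[c cC ->]|/ZP//] g.
rewrite inE => /predU1P[->|gs]; first by exists c.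
have [d gx] := XP x (mem_head x X) g gs; exists d.
have kerE u : (u \in lker (g - d *: \1%VF)) = (g u == d *: u).
  by rewrite memv_ker add_lfunE opp_lfunE scale_lfunE id_lfunE subr_eq0.
apply/eqP; rewrite -kerE.
apply: (eigen_components (f := f) (c := id) (s := C)) => //; rewrite ?map_id //.
  move=> u; rewrite !kerE => /eqP gu.
  by rewrite -(scomm f g) ?inE ?eqxx ?gs ?orbT // gu linearZ.
by rewrite -xE kerE gx.
Qed.

End Diagonalization.

Section Sums.
Variables (F : fieldType) (L : vectType F) (I : eqType) (V : I -> {vspace L}).

Lemma subv_seq_sum s U :
  (forall i, i \in s -> (V i <= U)%VS) -> (\sum_(i <- s) V i <= U)%VS.
Proof.
elim: s => [|i s IHs] VU; first by rewrite big_nil sub0v.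
rewrite big_cons subv_add VU ?mem_head // IHs // => j js.
by rewrite VU // inE js orbT.
Qed.

Lemma seq_sum_sup s i : i \in s -> (V i <= \sum_(i <- s) V i)%VS.
Proof.
elim: s => // j s IHs; rewrite inE big_cons => /predU1P[->|/IHs Vi].
  exact: addvSl.
exact: subv_trans Vi (addvSr _ _).
Qed.

Lemma mem_seq_sum s x : uniq s -> x \in (\sum_(i <- s) V i)%VS ->
  exists2 v : I -> L, (forall i, v i \in V i) & x = \sum_(i <- s) v i.
Proof.
elim: s x => [|i s IHs] x /=.
  rewrite big_nil memv0 => _ /eqP->.
  by exists (fun=> 0) => [i|]; rewrite ?mem0v ?big_nil.
case/andP=> iNs us; rewrite big_cons.
move=> /memv_addP[u uV [w /IHs[//|v vV ->] ->]].
exists (fun j => if j == i then u else v j) => [j|].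
  by case: eqP => [->|].
rewrite big_cons eqxx; congr (_ + _); apply: eq_big_seq => j js.
by case: eqP iNs => // <-; rewrite js.
Qed.

End Sums.

Section Trace.
Variables (F : fieldType) (L : vectType F) (n : nat) (X : n.-tuple L).
Hypothesis Xbasis : basis_of fullv X.

(** The basis is a parameter: an eigenbasis turns the trace into a sum of
    eigenvalues, and tr (f g) = tr (g f) holds in each basis. *)
Definition basis_trace (f : L -> L) : F := \sum_(i < n) coord X i (f X`_i).

Lemma basis_traceD (f g : L -> L) :
  basis_trace (fun x => f x + g x) = basis_trace f + basis_trace g.
Proof. by rewrite -big_split; apply: eq_bigr => i _; rewrite linearD. Qed.

Lemma basis_traceZ c (f : L -> L) :
  basis_trace (fun x => c *: f x) = c * basis_trace f.
Proof. by rewrite mulr_sumr; apply: eq_bigr => i _; rewrite linearZ. Qed.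

Lemma basis_traceC (f g : 'End(L)) :
  basis_trace (fun x => f (g x)) = basis_trace (fun x => g (f x)).
Proof.
have trE (u v : 'End(L)) : basis_trace (fun x => u (v x)) =
    \sum_(i < n) \sum_(j < n) coord X j (v X`_i) * coord X i (u X`_j).
  apply: eq_bigr => i _.
  rewrite {1}(coord_basis Xbasis (memvf (v X`_i))) !linear_sum.
  by apply: eq_bigr => j _; rewrite !linearZ.
rewrite !trE exchange_big; apply: eq_bigr => i _; apply: eq_bigr => j _.
exact: mulrC.
Qed.

Lemma basis_trace_eigen (f : L -> L) (c : 'I_n -> F) :
  (forall i : 'I_n, f X`_i = c i *: X`_i) -> basis_trace f = \sum_(i < n) c i.
Proof.
move=> fX; apply: eq_bigr => i _.
by rewrite fX linearZ /= coord_free ?(basis_free Xbasis) // eqxx mulr1.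
Qed.

End Trace.

(** * Combinatorics of the root system *)

Notation weight := (int * int)%type.

Definition G2_positive_weights : seq weight :=
  G2_positive_roots ((1, 0) : weight) ((0, 1) : weight).

Definition G2_weights : seq weight :=
  G2_positive_weights ++ map -%R G2_positive_weights.

Notation Phi := G2_weights.

Lemma mem_G2_weights p :
  (p \in Phi) = (p \in G2_positive_weights) || (- p \in G2_positive_weights).
Proof.
by rewrite mem_cat -{2}(opprK p) mem_map //; apply: oppr_inj.
Qed.

Lemma G2_weightsN p : (- p \in Phi) = (p \in Phi).
Proof. by rewrite !mem_G2_weights opprK orbC. Qed.

Lemma G2_zero_notin : 0 \notin Phi.
Proof. by []. Qed.

Lemma G2_double p : p \in Phi -> p + p \notin 0 :: Phi.
Proof. by move: p; apply/allP; vm_compute. Qed.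

(** The value of a root at the point of [H] where the short base root is 1 and
    the long one is 4: this makes all values distinct and nonzero. *)
Definition height4 (p : weight) : int := p.1 + p.2 * 4.

Lemma height4_inj : {in 0 :: Phi &, injective height4}.
Proof.
have all_inj : all (fun p => all (fun q =>
    (height4 p == height4 q) ==> (p == q)) (0 :: Phi)) (0 :: Phi).
  by vm_compute.
move=> p q pP qP /eqP pq; apply/eqP; apply: implyP pq.
exact: allP (allP all_inj p pP) q qP.
Qed.

(** The roots [s 0], ..., [s n] form the full string in direction [p], in which
    [q] is [s r] and has a successor. *)
Definition string_through (p q : weight) (r n : nat) : bool :=
  let s k := q - p *+ r + p *+ k in
  [&& (r < n)%N, s 0 - p \notin 0 :: Phi, s n + p \notin 0 :: Phi
    & all (fun k => s k \in Phi) (iota 0 n.+1)].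

Lemma root_string p q : p \in Phi -> q \in Phi -> p + q \in Phi ->
  exists r n, string_through p q r n.
Proof.
have all_strings : all (fun p => all (fun q => (p + q \in Phi) ==>
    has (fun r => has (string_through p q r) (iota 0 4)) (iota 0 4)) Phi) Phi.
  by vm_compute.
move=> pP qP pqP; move/allP/(_ p pP)/allP/(_ q qP): all_strings.
by rewrite pqP => /hasP[r _ /hasP[n _ rn]]; exists r, n.
Qed.

Section Subsequences.
Variable T : eqType.

Definition subseqs (s : seq T) : seq (seq T) :=
  foldr (fun x r => map (cons x) r ++ r) [:: [::]] s.

Lemma filter_subseqs (P : pred T) s : [seq x <- s | P x] \in subseqs s.
Proof.
elim: s => //= x s IHs; rewrite mem_cat; case: (P x); last by rewrite IHs orbT.
by rewrite map_f.
Qed.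

Lemma mem_subseqs (s t : seq T) : t \in subseqs s -> subseq t s.
Proof.
elim: s t => [|x s IHs] t /=; first by rewrite inE => /eqP->.
rewrite mem_cat => /orP[/mapP[u /IHs us ->]|/IHs ts].
  by rewrite /= eqxx.
exact: subseq_trans ts (subseq_cons s x).
Qed.

End Subsequences.

Definition sign_choices (s : seq weight) : seq (seq weight) :=
  foldr (fun p r => map (cons p) r ++ map (cons (- p)) r) [:: [::]] s.

Lemma sign_choice_mem (P : pred weight) s :
  [seq if P p then p else - p | p <- s] \in sign_choices s.
Proof.
elim: s => //= p s IHs; rewrite mem_cat; apply/orP.
by case: (P p); [left|right]; rewrite map_f.
Qed.

Lemma sign_choices_uniq Q : Q \in sign_choices G2_positive_weights -> uniq Q.
Proof. by move: Q; apply/allP; vm_compute. Qed.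

(** In this definition and the next one, the conditionals let the evaluation
    skip the branches that do not matter. *)
Definition closed_weights (Q : seq weight) : bool :=
  all (fun p => all (fun q => if p + q \in Phi then p + q \in Q else true) Q) Q.

Definition abelian_ideal_weights (Q S : seq weight) : bool :=
  if all (fun p => all (fun q => p + q \notin Phi) S) S then
    all (fun p =>
      all (fun q => if p + q \in Phi then p + q \in S else true) S) Q
  else false.

Definition abelian_ideal_weight_sets (Q : seq weight) : seq (seq weight) :=
  [seq S <- subseqs Q | abelian_ideal_weights Q S].

(** Of the 64 ways to choose one root in each opposite pair, those that pass
    the closure test are the positive systems. *)
Lemma abelian_ideal_weights_size Q :
    Q \in sign_choices G2_positive_weights -> closed_weights Q ->
  perm_eq (map size (abelian_ideal_weight_sets Q)) (iota 0 4).
Proof.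
move=> QP Qclosed.
have all_sizes : all (fun Q => if closed_weights Q then
    perm_eq (map size (abelian_ideal_weight_sets Q)) (iota 0 4) else true)
    (sign_choices G2_positive_weights).
  by vm_compute.
by have := allP all_sizes Q QP; rewrite Qclosed.
Qed.

(** * Lie brackets *)

Section LieBracket.
Variables (F : numClosedFieldType) (L : vectType F) (br : 'Hom(L, 'End(L))).
Hypotheses (br_lie : is_lie_bracket br) (br_simple : lie_simple br).

Lemma brDl x y z : br (x + y) z = br x z + br y z.
Proof. by rewrite linearD add_lfunE. Qed.

Lemma brDr x y z : br x (y + z) = br x y + br x z.
Proof. exact: linearD. Qed.

Lemma brZl c x y : br (c *: x) y = c *: br x y.
Proof. by rewrite linearZ scale_lfunE. Qed.

Lemma brNl x y : br (- x) y = - br x y.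
Proof. by rewrite linearN opp_lfunE. Qed.

Lemma brZr c x y : br x (c *: y) = c *: br x y.
Proof. exact: linearZ. Qed.

Lemma brC x y : br x y = - br y x.
Proof.
have [alt _] := br_lie; apply/eqP; rewrite -addr_eq0.
have := alt (x + y).
by rewrite brDl !brDr !alt addr0 add0r addrC => ->.
Qed.

Lemma br_jacobi x y z : br x (br y z) = br (br x y) z + br y (br x z).
Proof.
have [_ jac] := br_lie; have := jac x y z.
rewrite (brC z x) linearN (brC z (br x y)) -addrA => /eqP.
by rewrite addr_eq0 opprD !opprK addrC => /eqP.
Qed.

Lemma br_centerless x : br x = 0 -> x = 0.
Proof.
move=> x0; have [nab ideals] := br_simple.
have [|Z0|Zfull] := ideals (lker br).
  split=> [|y z _]; first exact: subvf.
  by rewrite !memv_ker brC => /eqP->; rewrite zero_lfunE oppr0 linear0.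
  by apply/eqP; rewrite -memv0 -Z0 memv_ker x0.
case: nab => y z _ _; have := memvf y; rewrite -Zfull memv_ker => /eqP->.
by rewrite zero_lfunE.
Qed.

(** Here [z] is a lowest weight vector of the copy of sl2 spanned by
    [x], [y] and their bracket: moving up with [x] and then down with [y]
    multiplies a vector of the string by an explicit scalar, which has to
    vanish where the string stops. With the eigenvalue of [x] written as
    twice [c], this scalar needs no division by 2. *)
Lemma sl2_string x y z c l n :
    br (br x y) x = (c *+ 2) *: x -> br (br x y) z = l *: z -> br y z = 0 ->
    z != 0 -> iter n.+1 (br x) z = 0 ->
  exists m, [/\ (m <= n)%N, l + c *+ m = 0
    & forall k, (k <= m)%N -> iter k (br x) z != 0].
Proof.
move=> hx hz yz z0 zn; pose e k := iter k (br x) z.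
have eS k : e k.+1 = br x (e k) by [].
have he k : br (br x y) (e k) = (l + c *+ 2 *+ k) *: e k.
  elim: k => [|k IHk]; first by rewrite mulr0n addr0.
  rewrite eS br_jacobi hx IHk brZl brZr -scalerDl (mulrS _ k).
  by rewrite addrCA.
have ye k : br y (e k.+1) = - ((l + c *+ k) *+ k.+1) *: e k.
  elim: k => [|k IHk]; rewrite eS br_jacobi (brC y x) brNl he.
    by rewrite yz linear0 !mulr0n !addr0 scaleNr.
  rewrite IHk brZr -eS -scaleNr -scalerDl.
  by congr (_ *: _); ring.
have ex_stop : exists m, e m.+1 == 0 by exists n; rewrite /e zn.
case: (ex_minnP ex_stop) => m em minm.
have nz k : (k <= m)%N -> e k != 0.
  case: k => [|k] //; apply: contraTN => /minm.
  by rewrite -ltnNge.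
exists m; split=> //; first by apply: minm; rewrite /e zn.
have := ye m; rewrite (eqP em) linear0 => /esym/eqP.
by rewrite scaler_eq0 (negPf (nz m _)) // orbF oppr_eq0 mulrn_eq0 /= => /eqP.
Qed.

End LieBracket.

(** * Root spaces *)

Section RootSpaces.
Variables (F : numClosedFieldType) (L : vectType F) (br : 'Hom(L, 'End(L))).
Hypotheses (br_lie : is_lie_bracket br) (br_simple : lie_simple br).
Variable H : {vspace L}.
Hypothesis H_cartan : cartan_subalgebra br H.
Variables a b : 'Hom(subvs_of H, F^o).
Hypothesis ab_free : free [:: a; b].
Hypothesis ab_G2 : forall alpha : 'Hom(subvs_of H, F^o),
  is_root br alpha = (alpha \in G2_positive_roots a b)
                     || (- alpha \in G2_positive_roots a b).

Definition functional (p : weight) : 'Hom(subvs_of H, F^o) :=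
  a *~ p.1 + b *~ p.2.

(** The projection to [H] makes functionals on [H] applicable to vectors of
    [L]; only the values at vectors of [H] matter. *)
Definition weight_val (p : weight) (h : L) : F := functional p (vsproj H h).

Definition rspace (p : weight) : {vspace L} := rootspace br (functional p).

Lemma functionalE p h :
  functional p h = (a h : F) *~ p.1 + (b h : F) *~ p.2.
Proof.
rewrite add_lfunE -(scaler_int p.1) -(scaler_int p.2) !scale_lfunE.
by rewrite !scaler_int.
Qed.

Lemma functionalD p q : functional (p + q) = functional p + functional q.
Proof. by rewrite /functional !mulrzDr addrACA. Qed.

Lemma functionalN p : functional (- p) = - functional p.
Proof. by rewrite /functional !mulrNz opprD. Qed.

Lemma weight_val0 h : weight_val 0 h = 0.
Proof. by rewrite /weight_val functionalE /= !mulr0z addr0. Qed.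

Lemma weight_valD p q h :
  weight_val (p + q) h = weight_val p h + weight_val q h.
Proof. by rewrite /weight_val functionalD add_lfunE. Qed.

Lemma weight_valN p h : weight_val (- p) h = - weight_val p h.
Proof. by rewrite /weight_val functionalN opp_lfunE. Qed.

Lemma weight_valMn p k h : weight_val (p *+ k) h = weight_val p h *+ k.
Proof.
by elim: k => [|k IHk]; rewrite ?weight_val0 // !mulrS weight_valD IHk.
Qed.

Lemma mem_rspace p x :
  x \in rspace p <-> forall h, h \in H -> br h x = weight_val p h *: x.
Proof.
rewrite mem_rootspace; split=> [xp h hH|xp h].
  by have := xp (vsproj H h); rewrite vsprojK.
by rewrite xp ?subvsP // /weight_val vsvalK.
Qed.

Lemma dual_basis (u v : F) : exists2 h, h \in H & forall p,
  weight_val p h = u *~ p.1 + v *~ p.2.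
Proof.
suffices [h [ah bh]] : exists h, (a h : F) = u /\ (b h : F) = v.
  exists (vsval h) => [|p]; first exact: subvsP.
  by rewrite /weight_val vsvalK functionalE ah bh.
move: ab_free; rewrite free_cons seq1_free span_seq1 => /andP[aNb b0].
have /lfunPn[k] := b0; rewrite zero_lfunE => bk.
pose g := a - ((a k : F) / (b k : F)) *: b.
have g0 : g != 0.
  apply: contraNneq aNb => /eqP; rewrite subr_eq0 => /eqP->.
  by rewrite memvZ ?memv_line.
have /lfunPn[m] := g0; rewrite zero_lfunE => gm.
have aE h : (a h : F) = (g h : F) + (a k : F) / (b k : F) * (b h : F).
  by rewrite add_lfunE opp_lfunE scale_lfunE subrK.
have gk : (g k : F) = 0.
  by rewrite add_lfunE opp_lfunE scale_lfunE /= /(_ *: _) /= divfK ?subrr.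
pose t := (u - (a k : F) / (b k : F) * v) / (g m : F).
pose s := (v - t * (b m : F)) / (b k : F).
have gh : (g (s *: k + t *: m) : F) = u - (a k : F) / (b k : F) * v.
  by rewrite linearD !linearZ /= gk scaler0 add0r /(_ *: _) /= divfK.
have bh : (b (s *: k + t *: m) : F) = v.
  by rewrite linearD !linearZ /= /(_ *: _) /= divfK // subrK.
by exists (s *: k + t *: m); rewrite aE gh bh subrK.
Qed.

Lemma weight_val_inj p : (forall h, h \in H -> weight_val p h = 0) -> p = 0.
Proof.
move=> p0; have [h hH hE] := dual_basis 1 0; have [k kH kE] := dual_basis 0 1.
have := p0 h hH; have := p0 k kH; rewrite hE kE !mul0rz addr0 add0r.
by case: p {p0 hE kE} => i j /= /eqP + /eqP; rewrite !intr_eq0 => /eqP-> /eqP->.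
Qed.

Lemma functional_inj : injective functional.
Proof.
move=> p q pq; apply/eqP; rewrite -subr_eq0; apply/eqP/weight_val_inj => h _.
by rewrite /weight_val functionalD functionalN pq subrr zero_lfunE.
Qed.

Lemma functional0 : functional 0 = 0.
Proof. by rewrite /functional !mulr0z addr0. Qed.

Lemma G2_positive_rootsE :
  G2_positive_roots a b = map functional G2_positive_weights.
Proof.
have fMn p k : functional (p *+ k) = functional p *+ k.
  by elim: k => [|k IHk]; rewrite ?functional0 // !mulrS functionalD IHk.
have fa : functional (1, 0) = a by rewrite /functional mulr0z addr0.
have fb : functional (0, 1) = b by rewrite /functional mulr0z add0r.
by rewrite /G2_positive_roots -fa -fb -!fMn -!functionalD.
Qed.

Lemma is_root_functional p : is_root br (functional p) = (p \in Phi).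
Proof.
rewrite ab_G2 G2_positive_rootsE -functionalN.
by rewrite !(mem_map functional_inj) mem_G2_weights.
Qed.

Lemma is_root_weight alpha :
  is_root br alpha -> exists2 p, p \in Phi & alpha = functional p.
Proof.
rewrite ab_G2 G2_positive_rootsE => /orP[] /mapP[p pP].
  by move=> ->; exists p; rewrite // mem_G2_weights pP.
move=> /eqP; rewrite eqr_oppLR -functionalN => /eqP->.
by exists (- p); rewrite // mem_G2_weights opprK pP orbT.
Qed.

Lemma rspace_neq0 p : p \in Phi -> rspace p != 0%VS.
Proof. by rewrite -is_root_functional => /andP[]. Qed.

Lemma rspace_eq0 p : p \notin 0 :: Phi -> rspace p = 0%VS.
Proof.
rewrite inE negb_or -is_root_functional /is_root negb_and !negbK.
by rewrite -functional0 (inj_eq functional_inj) => /andP[/negPf-> /eqP].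
Qed.

(** A Cartan subalgebra is maximal among all subspaces on which the bracket
    vanishes, so it contains every vector that it centralizes. *)
Lemma rspace0 : rspace 0 = H.
Proof.
have [H_ab H_max _] := H_cartan; apply/eqP; rewrite eqEsubv.
apply/andP; split; apply/subvP => x; last first.
  by move=> xH; apply/mem_rspace => h hH; rewrite weight_val0 scale0r H_ab.
move/mem_rspace => x0; have xH h : h \in H -> br h x = 0.
  by move=> /x0; rewrite weight_val0 scale0r.
have [br_alt _] := br_lie.
rewrite -(H_max (H + <[x]>)%VS) ?addvSl //.
  by apply: subvP (addvSr _ _) _ _; rewrite memv_line.
move=> u v /memv_addP[h hH [_ /vlineP[c ->] ->]].
move=> /memv_addP[k kH [_ /vlineP[d ->] ->]].
rewrite brDl !brDr !(brZr, brZl) br_alt H_ab // (xH h) //.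
by rewrite (brC br_lie x) xH // oppr0 !scaler0 !addr0.
Qed.

Lemma br_rspace p q x y :
  x \in rspace p -> y \in rspace q -> br x y \in rspace (p + q).
Proof.
move=> /mem_rspace xp /mem_rspace yq; apply/mem_rspace => h hH.
by rewrite br_jacobi // (xp h) // (yq h) // brZl brZr -scalerDl weight_valD.
Qed.

Lemma br_rspace_eq0 p q x y :
  p + q \notin 0 :: Phi -> x \in rspace p -> y \in rspace q -> br x y = 0.
Proof.
move=> pq xp yq; apply/eqP; rewrite -memv0 -(rspace_eq0 pq).
exact: br_rspace.
Qed.

Lemma joint_eigenvector_weight x :
    (forall h, h \in H -> exists c, br h x = c *: x) ->
  exists2 p, p \in 0 :: Phi & x \in rspace p.
Proof.
move=> xeig; have [->|x0] := eqVneq x 0; first by exists 0; rewrite ?mem0v.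
pose cf (h : subvs_of H) : F^o := coord [tuple x] ord0 (br (vsval h) x).
have cf_lin : linear cf.
  by move=> c u v; rewrite /cf !linearP add_lfunE scale_lfunE linearP.
have [al alE] := exists_lfun cf_lin.
have alx : x \in rootspace br al.
  apply/mem_rootspace => h; rewrite alE /cf.
  have [c ->] := xeig (vsval h) (subvsP h).
  rewrite linearZ /= (@coord_free _ _ _ [tuple x] ord0 ord0) ?seq1_free //.
  by rewrite /(_ *: _) /= mulr1.
have [al0|al0] := eqVneq al 0.
  by exists 0; rewrite // /rspace functional0 -al0.
have [|p pP alp] := @is_root_weight al; last first.
  by exists p; [rewrite inE pP orbT | rewrite /rspace -alp].
rewrite /is_root al0 /=; apply: contraNneq x0 => W0.
by rewrite -memv0 -W0.
Qed.

(** [H] is diagonalized simultaneously through a basis of [H]; the eigenvalues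
    of each joint eigenvector depend linearly on the element of [H], so they
    form a root or 0. *)
Lemma weight_basis : exists2 X : seq L, basis_of fullv X &
  forall x, x \in X -> exists2 p, p \in 0 :: Phi & x \in rspace p.
Proof.
have [H_ab _ H_diag] := H_cartan.
have [||X Xfull Xeig] := @joint_eigenvectors_span F L (map br (vbasis H)).
- move=> _ /mapP[h /vbasis_mem/H_diag[X Xbasis XP] ->].
  by exists X; rewrite ?(span_basis Xbasis).
- move=> _ _ /mapP[h /vbasis_mem hH ->] /mapP[k /vbasis_mem kH ->] x.
  by rewrite br_jacobi // (H_ab h k) // linear0 zero_lfunE add0r.
have [Y [YX Yfree YE]] := free_subseq X.
exists Y => [|x /YX/Xeig xeig]; first by rewrite /basis_of YE Xfull eqxx.
apply: joint_eigenvector_weight => h hH; rewrite (coord_vbasis hH).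
have /fin_all_exists[c cE] : forall i : 'I_(\dim H), exists c,
    br (vbasis H)`_i x = c *: x.
  by move=> i; apply/xeig/map_f/mem_nth; rewrite size_tuple.
exists (\sum_(i < \dim H) coord (vbasis H) i h * c i).
rewrite linear_sum sum_lfunE scaler_suml; apply: eq_bigr => i _.
by rewrite brZl cE scalerA.
Qed.

(** Every root takes at [k] the conjugate of its value at [h], because this
    holds for the two base roots and the other ones are integral combinations
    of them. *)
Lemma exists_conj h : exists2 k, k \in H & forall p,
  weight_val p k = (weight_val p h)^*.
Proof.
have [k kH kE] := dual_basis (a (vsproj H h) : F)^* (b (vsproj H h) : F)^*.
exists k => // p; rewrite kE /weight_val functionalE.
by rewrite rmorphD /= !rmorphMz.
Qed.

(** * The Killing form *)

Section KillingForm.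
Variables (n : nat) (X : n.-tuple L) (wX : 'I_n -> weight).
Hypotheses (Xbasis : basis_of fullv X)
           (X_rspace : forall i : 'I_n, X`_i \in rspace (wX i)).

Definition killing (x y : L) : F := basis_trace X (fun z => br x (br y z)).

Lemma killingC x y : killing x y = killing y x.
Proof. exact: basis_traceC. Qed.

Lemma killingDl x y z : killing (x + y) z = killing x z + killing y z.
Proof. by rewrite -basis_traceD; apply: eq_bigr => i _; rewrite brDl. Qed.

Lemma killingZl c x y : killing (c *: x) y = c * killing x y.
Proof. by rewrite -basis_traceZ; apply: eq_bigr => i _; rewrite brZl. Qed.

Lemma killingNl x y : killing (- x) y = - killing x y.
Proof. by rewrite -scaleN1r killingZl mulN1r. Qed.

Lemma killing0l y : killing 0 y = 0.
Proof. by rewrite -(scale0r 0) killingZl mul0r. Qed.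

Lemma killing_linear y : linear (fun x => killing x y : F^o).
Proof. by move=> c u v; rewrite killingDl killingZl. Qed.

Lemma killing_inv x y z : killing (br x y) z = killing x (br y z).
Proof.
pose tr := @basis_trace _ _ _ X.
have trC : tr (fun w => br y (br x (br z w))) =
           tr (fun w => br x (br z (br y w))).
  transitivity (tr (fun w => br y ((br x \o br z)%VF w))).
    by apply: eq_bigr => i _; rewrite comp_lfunE.
  by rewrite /tr basis_traceC //; apply: eq_bigr => i _; rewrite comp_lfunE.
apply: (addIr (tr (fun w => br y (br x (br z w))))).
rewrite [in RHS]trC -!basis_traceD; apply: eq_bigr => i _.
rewrite -br_jacobi // -brDr; congr (coord _ _ (br _ _)).
by rewrite -br_jacobi.
Qed.

Lemma killing_H x y h p : x \in rspace p -> h \in H ->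
  killing h (br x y) = weight_val p h * killing x y.
Proof.
move=> /mem_rspace xp hH; rewrite -killing_inv xp // -basis_traceZ.
by apply: eq_bigr => i _; rewrite brZl.
Qed.

(** By invariance, the products of [killing x y] with [weight_val p h] and with
    [- weight_val q h] agree for each [h] in [H]. *)
Lemma killing_rspace p q x y : x \in rspace p -> y \in rspace q ->
  killing x y != 0 -> q = - p.
Proof.
move=> xp yq Kxy; apply/eqP; rewrite -addr_eq0.
apply/eqP/weight_val_inj => h hH.
have /eqP := killing_H y xp hH; rewrite (brC br_lie x) killingC killingNl.
rewrite killingC (killing_H x yq hH) (killingC y) -mulNr (inj_eq (mulIf Kxy)).
by rewrite eq_sym -addr_eq0 weight_valD addrC => /eqP.
Qed.

(** For [k] conjugate to [h] in the coordinates given by the roots, the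
    trace of [ad h ad k] is the sum of the squares of the moduli of the
    eigenvalues of [ad h]. *)
Lemma killing_conj h k : h \in H -> k \in H ->
    (forall p, weight_val p k = (weight_val p h)^*) -> killing h k = 0 ->
  h = 0.
Proof.
move=> hH kH kE; rewrite /killing.
have hX i : br h X`_(i : 'I_n) = weight_val (wX i) h *: X`_i.
  by have /mem_rspace-> := X_rspace i.
rewrite (basis_trace_eigen Xbasis (c := fun i => `|weight_val (wX i) h| ^+ 2)).
  move/eqP; rewrite psumr_eq0 => [/allP h0|i _]; last by rewrite exprn_ge0.
  apply: (br_centerless br_lie br_simple); apply/lfunP => x.
  rewrite (coord_basis Xbasis (memvf x)) linear_sum zero_lfunE /=.
  rewrite big1 // => i _; rewrite brZr hX.
  have := h0 i (mem_index_enum i); rewrite expf_eq0 normr_eq0 /= => /eqP->.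
  by rewrite scale0r scaler0.
move=> i; have /mem_rspace-> // := X_rspace i.
by rewrite kE brZr hX scalerA mulrC normCK.
Qed.

Lemma killing_H_nondegenerate h : h \in H ->
  (forall k, k \in H -> killing k h = 0) -> h = 0.
Proof.
move=> hH h0; have [k kH kE] := exists_conj h.
by apply: (killing_conj hH kH kE); rewrite killingC h0.
Qed.

(** The radical is an ideal, and it is not all of [L] since the form does not
    vanish on [H]. *)
Lemma killing_nondegenerate x : (forall i : 'I_n, killing x X`_i = 0) -> x = 0.
Proof.
have /fin_all_exists[g gE] : forall i : 'I_n, exists g : 'Hom(L, F^o),
    forall x, g x = killing x X`_i.
  by move=> i; apply: exists_lfun (killing_linear _).
pose rad := (\bigcap_(i < n) lker (g i))%VS.
have radP u : reflect (forall i, killing u X`_(i : 'I_n) = 0) (u \in rad).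
  rewrite memvE; apply: (iffP subv_bigcapP) => uP i => [|_].
    by have := uP i isT; rewrite -memvE memv_ker gE => /eqP.
  by rewrite -memvE memv_ker gE uP.
have rad_full u v : u \in rad -> killing u v = 0.
  move=> /radP uX; rewrite (coord_basis Xbasis (memvf v)) killingC.
  have [f fE] := exists_lfun (killing_linear u).
  rewrite -fE linear_sum big1 // => i _.
  by rewrite linearZ /= fE killingC uX scaler0.
have [_ ideals] := br_simple.
have [|rad0 /radP|radL] := ideals rad; last 1 first.
- have [h hH hE] := dual_basis 1 0.
  have [k kH kE] := exists_conj h.
  have h0 : h = 0.
    by apply: (killing_conj hH kH kE); apply: rad_full; rewrite radL memvf.
  have /eqP := hE (1, 0).
  by rewrite h0 /weight_val !linear0 mul0rz addr0 eq_sym oner_eq0.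
- split=> [|u v _ vR]; first exact: subvf.
  by apply/radP => i; rewrite brC // killingNl killing_inv rad_full ?oppr0.
by rewrite rad0 memv0 => /eqP.
Qed.

(** Choose [y] not orthogonal to [x] and set [h] to be their bracket. If [p]
    vanished at [h], then [h] would be orthogonal to its conjugate, hence 0,
    against the formula of [killing_H]. For the second claim, a vector
    [z'] of weight [p] orthogonal to [y] commutes with [y], and with [x] because
    2 p is not a root; so it is killed by [h], which multiplies it by a
    nonzero scalar. *)
Lemma opposite_root_vector p x : p \in Phi -> x \in rspace p -> x != 0 ->
  exists y, [/\ y \in rspace (- p), weight_val p (br x y) != 0
              & (rspace p <= <[x]>)%VS].
Proof.
move=> pP xp x0.
have [i Kxi] : exists i : 'I_n, killing x X`_i != 0.
  apply/existsP; apply: contraNT x0; rewrite negb_exists => /forallP Kx.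
  by apply/eqP/killing_nondegenerate => i; apply/eqP/negPn/Kx.
pose y := X`_i.
have yp : y \in rspace (- p).
  by rewrite -(killing_rspace xp (X_rspace i) Kxi) X_rspace.
have brH z : z \in rspace p -> br z y \in H.
  by move=> zp; rewrite -rspace0 -(subrr p) br_rspace.
have hp : weight_val p (br x y) != 0.
  apply/eqP => hp0; have [k kH kE] := exists_conj (br x y).
  have h0 : br x y = 0.
    apply: (killing_conj (brH x xp) kH kE).
    by rewrite killingC (killing_H y xp kH) kE hp0 conjC0 mul0r.
  move: pP; rewrite (_ : p = 0) //; apply: weight_val_inj => k' k'H.
  have /eqP := killing_H y xp k'H; rewrite h0 killingC killing0l.
  by rewrite eq_sym mulf_eq0 (negPf Kxi) orbF => /eqP.
exists y; split=> //; apply/subvP => z zp.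
pose t := killing z y / killing x y; pose z' := z - t *: x.
have z'p : z' \in rspace p by rewrite memvB ?memvZ.
have z'y : br z' y = 0.
  apply: killing_H_nondegenerate => [|k kH]; first exact: brH.
  rewrite (killing_H y z'p kH) killingDl killingNl.
  by rewrite killingZl divfK // subrr mulr0.
have /eqP := br_jacobi br_lie y x z'.
rewrite (br_rspace_eq0 (G2_double pP) xp z'p) linear0 (brC br_lie y z') z'y.
rewrite oppr0 linear0 addr0 (brC br_lie y x) brNl.
have /mem_rspace-> := z'p; last exact: brH.
rewrite eq_sym oppr_eq0 scaler_eq0 (negPf hp) subr_eq0 => /eqP->.
by rewrite memvZ ?memv_line.
Qed.

End KillingForm.

(** * One-dimensionality and brackets of root spaces *)

Lemma sl2_triple p x : p \in Phi -> x \in rspace p -> x != 0 ->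
  exists y, [/\ y \in rspace (- p), weight_val p (br x y) != 0
              & rspace p = <[x]>%VS].
Proof.
have [X Xbasis XP] := weight_basis.
have /fin_all_exists[wX wXP] : forall i : 'I_(size X), exists p,
    X`_i \in rspace p.
  by move=> i; have [|q _ xq] := XP X`_i; [rewrite mem_nth | exists q].
move=> pP xp x0.
have [y [yp hp sub]] :=
  opposite_root_vector (X := in_tuple X) Xbasis wXP pP xp x0.
by exists y; split=> //; apply/eqP; rewrite eqEsubv sub -memvE.
Qed.

Lemma rspace_line p x : p \in Phi -> x \in rspace p -> x != 0 ->
  rspace p = <[x]>%VS.
Proof. by move=> pP xp x0; have [y []] := sl2_triple pP xp x0. Qed.

Lemma root_vector p : p \in Phi -> exists2 x, x \in rspace p & x != 0.
Proof.
move=> /rspace_neq0 W0; exists (vpick (rspace p)); first exact: memv_pick.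
by rewrite vpick0.
Qed.

Lemma iter_br_rspace p q x z k : x \in rspace p -> z \in rspace q ->
  iter k (br x) z \in rspace (q + p *+ k).
Proof.
move=> xp zq; elim: k => [|k IHk]; first by rewrite addr0.
by rewrite mulrS addrCA /= br_rspace.
Qed.

(** Let [s 0], ..., [s n] be the string of roots through [q] in direction [p].
    A vector of weight [s 0] dies after m1 + 1 steps up, which makes its
    eigenvalue for the coroot -m1, and a vector of weight [s n] dies after
    m2 + 1 steps down, which makes its eigenvalue m2. The difference of the
    two is 2n, while m1 and m2 are at most n, so that both are n: the string
    of vectors does not stop before the string of roots. *)
Lemma root_bracket_neq0 p q x z :
    p \in Phi -> q \in Phi -> p + q \in Phi ->
    x \in rspace p -> z \in rspace q -> x != 0 -> z != 0 ->
  br x z != 0.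
Proof.
move=> pP qP pqP xp zq x0 z0.
have [r [n /and4P[rn low high /allP mid]]] := root_string pP qP pqP.
pose s k := q - p *+ r + p *+ k.
have sP k : (k <= n)%N -> s k \in Phi by move=> kn; rewrite mid // mem_iota.
have [y [yp hp _]] := sl2_triple pP xp x0.
have hH : br x y \in H by rewrite -rspace0 -(subrr p) br_rspace.
pose d := weight_val p (br x y) / 2.
have dE : weight_val p (br x y) = d *+ 2.
  by rewrite -mulr_natr divfK // pnatr_eq0.
have d0 : d != 0 by apply: contraNneq hp; rewrite dE => ->; rewrite mul0rn.
have [v vs v0] := root_vector (sP 0%N isT).
have [u us u0] := root_vector (sP n (leqnn n)).
have [m1 [m1n hm1 v_neq0]] : exists m, [/\ (m <= n)%N,
    weight_val (s 0%N) (br x y) + d *+ m = 0 &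
    forall k, (k <= m)%N -> iter k (br x) v != 0].
  apply: (sl2_string br_lie (y := y)) => //.
  - by rewrite -dE; have /mem_rspace-> := xp.
  - by have /mem_rspace-> := vs.
  - by apply: (br_rspace_eq0 _ yp vs); rewrite addrC.
  apply/eqP; rewrite -memv0 -(rspace_eq0 high).
  have -> : s n + p = s 0%N + p *+ n.+1 by rewrite /s addr0 mulrSr addrA.
  exact: iter_br_rspace.
have [m2 [m2n hm2 _]] : exists m, [/\ (m <= n)%N,
    - weight_val (s n) (br x y) + d *+ m = 0 &
    forall k, (k <= m)%N -> iter k (br y) u != 0].
  apply: (sl2_string br_lie (y := x)) => //.
  - rewrite (brC br_lie y) brNl; have /mem_rspace-> // := yp.
    by rewrite weight_valN scaleNr opprK dE.
  - rewrite (brC br_lie y) brNl; have /mem_rspace-> // := us.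
    by rewrite scaleNr.
  - by apply: (br_rspace_eq0 _ xp us); rewrite addrC.
  apply/eqP; rewrite -memv0 -(rspace_eq0 low).
  have -> : s 0%N - p = s n + (- p) *+ n.+1.
    by rewrite /s addr0 mulNrn mulrSr opprD addrA addrK.
  exact: iter_br_rspace.
have m1E : m1 = n.
  have snE : weight_val (s n) (br x y) =
             weight_val (s 0%N) (br x y) + d *+ 2 *+ n.
    by rewrite /s addr0 weight_valD weight_valMn dE.
  have : (d *+ (m1 + m2) == d *+ (2 * n)).
    have wE : weight_val (s 0%N) (br x y) = - (d *+ m1).
      by apply/eqP; rewrite -addr_eq0 hm1.
    rewrite -subr_eq0 mulrnDr mulrnA; apply/eqP; rewrite -[RHS]hm2 snE wE.
    by rewrite opprD opprK addrAC.
  rewrite -!(mulr_natr d) (inj_eq (mulfI d0)) eqr_nat mul2n -addnn => /eqP mE.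
  apply/eqP; rewrite eqn_leq m1n -(leq_add2r n) -mE leq_add2l.
  exact: m2n.
have : iter r (br x) v \in rspace q.
  have -> : q = s 0%N + p *+ r by rewrite /s addr0 subrK.
  exact: iter_br_rspace.
rewrite (rspace_line qP zq z0) => /vlineP[t vr].
have := v_neq0 r.+1; rewrite m1E => /(_ rn) /=; rewrite vr brZr.
by apply: contraNneq => ->; rewrite scaler0.
Qed.

(** * Subspaces stable under the Cartan subalgebra *)

Lemma regular_element : exists2 h, h \in H & forall p,
  weight_val p h = (height4 p)%:~R.
Proof.
have [h hH hE] := dual_basis 1 4; exists h => // p.
by rewrite hE /height4 intrD intrM mulrzl.
Qed.

(** On an element of [H] at which the roots take distinct nonzero values, the
    eigenspaces of the adjoint map are [H] and the root spaces. *)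
Lemma rspace_components (U : {vspace L}) (s : seq weight) (w : weight -> L) :
    (forall h u, h \in H -> u \in U -> br h u \in U) ->
    uniq s -> {subset s <= 0 :: Phi} -> (forall p, w p \in rspace p) ->
    \sum_(p <- s) w p \in U ->
  forall p, p \in s -> w p \in U.
Proof.
move=> HU us sP wP; have [h hH hE] := regular_element.
apply: (eigen_components (f := br h) (c := fun p => (height4 p)%:~R)).
- by move=> u; apply: HU.
- rewrite map_inj_in_uniq // => p q ps qs /intr_inj.
  by apply: height4_inj; apply: sP.
- by move=> p _; have /mem_rspace-> := wP p; rewrite // hE.
Qed.

Lemma rspace_capv p q : p \in 0 :: Phi -> q \in 0 :: Phi -> p != q ->
  (rspace p :&: rspace q = 0)%VS.
Proof.
move=> pP qP pq; apply/eqP; rewrite -subv0; apply/subvP => x.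
rewrite memv_cap memv0 => /andP[/mem_rspace xp /mem_rspace xq].
have [h hH hE] := regular_element.
have /eqP := xp h hH; rewrite (xq h hH) !hE -subr_eq0 -scalerBl scaler_eq0.
rewrite subr_eq0 => /orP[/eqP/intr_inj/height4_inj qp|//].
by move: pq; rewrite qp ?eqxx.
Qed.

Definition weight_sum (s : seq weight) : {vspace L} :=
  (\sum_(p <- s) rspace p)%VS.

Lemma dim_weight_sum s : uniq s -> {subset s <= Phi} ->
  \dim (weight_sum s) = size s.
Proof.
elim: s => [|p s IHs] /=; first by rewrite /weight_sum big_nil dimv0.
case/andP=> pNs us sP; have pP := sP p (mem_head p s).
have sP' : {subset s <= Phi} by move=> q qs; rewrite sP // inE qs orbT.
rewrite /weight_sum big_cons -/(weight_sum s) dimv_disjoint_sum ?IHs //.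
  have [x xp x0] := root_vector pP.
  by rewrite (rspace_line pP xp x0) dim_vline x0.
apply/eqP; rewrite -subv0; apply/subvP => x; rewrite memv_cap => /andP[xp].
case/(mem_seq_sum us) => w wP xE; rewrite xE big_seq memv_suml // => q qs.
have sP0 : {subset s <= 0 :: Phi} by move=> k ks; rewrite inE sP' ?orbT.
have pq : p != q by apply: contraNneq pNs => ->.
have pP0 : p \in 0 :: Phi by rewrite inE pP orbT.
rewrite -(rspace_capv pP0 (sP0 q qs) pq) memv_cap wP andbT.
apply: (rspace_components _ us sP0 wP _ qs); last by rewrite -xE.
by move=> h u hH /[dup] up /mem_rspace->; rewrite // memvZ.
Qed.

(** * Abelian ideals of a Borel subalgebra *)

Section Borel.
Variables (P : seq 'Hom(subvs_of H, F^o)) (bor : {vspace L}).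
Hypotheses (P_positive : positive_system br P)
           (borE : bor = (H + \sum_(alpha <- P) rootspace br alpha)%VS).

Definition positive_weight (p : weight) : bool := functional p \in P.

Definition borel_weights : seq weight :=
  [seq if positive_weight p then p else - p | p <- G2_positive_weights].

Notation Q := borel_weights.

Lemma positive_weightN p :
  p \in Phi -> positive_weight (- p) = ~~ positive_weight p.
Proof.
have [_ xorP _] := P_positive; rewrite -is_root_functional => /xorP.
by rewrite -functionalN /positive_weight => /addbP->.
Qed.

Lemma mem_borel_weights p : (p \in Q) = (p \in Phi) && positive_weight p.
Proof.
apply/mapP/andP=> [[q qP ->]|[]].
  have qPhi : q \in Phi by rewrite mem_G2_weights qP.
  case: (boolP (positive_weight q)) => [//|qN].
  by rewrite G2_weightsN positive_weightN.
move=> pPhi pP; move: (pPhi); rewrite mem_G2_weights => /orP[]pQ.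
  by exists p; rewrite // pP.
by exists (- p); rewrite // positive_weightN // pP opprK.
Qed.

Lemma borel_weights_sub : {subset Q <= Phi}.
Proof. by move=> p; rewrite mem_borel_weights => /andP[]. Qed.

Lemma borel_weights_choice : Q \in sign_choices G2_positive_weights.
Proof. exact: sign_choice_mem. Qed.

Lemma borel_weights_uniq : uniq Q.
Proof. exact: sign_choices_uniq borel_weights_choice. Qed.

Lemma borel_weights_closed p q :
  p \in Q -> q \in Q -> p + q \in Phi -> p + q \in Q.
Proof.
have [_ _ P_closed] := P_positive.
rewrite !mem_borel_weights => /andP[pP pQ] /andP[qP qQ] pqP.
rewrite pqP /positive_weight functionalD P_closed //.
by rewrite -functionalD is_root_functional.
Qed.

Lemma borel_weights_add p q :
  p \in Q -> q \in Q -> p + q \in 0 :: Phi -> p + q \in Phi.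
Proof.
move=> pQ qQ; rewrite inE => /predU1P[/eqP|//].
rewrite addrC addr_eq0 => /eqP qE.
move: qQ pQ; rewrite qE !mem_borel_weights G2_weightsN => /andP[pP].
by rewrite positive_weightN // => /negPf->; rewrite andbF.
Qed.

Lemma borel_weights_size :
  perm_eq (map size (abelian_ideal_weight_sets Q)) (iota 0 4).
Proof.
apply: abelian_ideal_weights_size; first exact: borel_weights_choice.
apply/allP => p pQ; apply/allP => q qQ; case: ifP => // pqP.
exact: borel_weights_closed.
Qed.

Lemma borel_weightsN p : p \in Phi -> (p \in Q) || (- p \in Q).
Proof.
move=> pP; rewrite !mem_borel_weights G2_weightsN pP positive_weightN //.
exact: orbN.
Qed.

Lemma borelE : bor = (H + weight_sum Q)%VS.
Proof.
have [P_root _ _] := P_positive; rewrite borE; congr (_ + _)%VS.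
apply/eqP; rewrite eqEsubv; apply/andP; split; apply: subv_seq_sum.
  move=> al alP; have [p pP alE] := is_root_weight (P_root al alP).
  have pQ : p \in Q by rewrite mem_borel_weights pP /positive_weight -alE.
  by rewrite alE; apply: (@seq_sum_sup _ _ _ rspace Q p).
move=> p; rewrite mem_borel_weights => /andP[_ pP].
exact: (@seq_sum_sup _ _ _ (@rootspace _ _ br H) P (functional p) pP).
Qed.

Lemma H_sub_borel h : h \in H -> h \in bor.
Proof. by rewrite borelE; apply/subvP/addvSl. Qed.

Lemma rspace_sub_borel p x : p \in Q -> x \in rspace p -> x \in bor.
Proof.
move=> pQ xp; rewrite borelE; apply: (subvP (addvSr _ _)).
exact: (subvP (seq_sum_sup _ pQ)).
Qed.

Lemma mem_borel x : x \in bor -> exists2 w : weight -> L,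
  (forall p, w p \in rspace p) & x = w 0 + \sum_(p <- Q) w p.
Proof.
have u0Q : uniq (0 :: Q).
  rewrite cons_uniq borel_weights_uniq andbT.
  by apply: contra G2_zero_notin; apply: borel_weights_sub.
have -> : bor = (\sum_(p <- 0%R :: Q) rspace p)%VS.
  by rewrite big_cons rspace0 borelE.
by case/(mem_seq_sum u0Q) => w wP ->; exists w; rewrite ?big_cons.
Qed.

(** With [h], the ideal contains its bracket with each root vector of [Q]. The
    bracket of [h] with that vector is 0, so the square of the eigenvalue is 0.
    Hence all roots vanish at [h], and [h] is central. *)
Lemma abelian_ideal_H (I : {vspace L}) h :
  lie_ideal br bor I -> lie_abelian br I -> h \in I -> h \in H -> h = 0.
Proof.
move=> [_ bI] Iab hI hH.
have Q0 p : p \in Q -> weight_val p h = 0.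
  move=> pQ; have [x xp x0] := root_vector (borel_weights_sub pQ).
  have hx : br h x = weight_val p h *: x by have /mem_rspace-> := xp.
  have hxI : br h x \in I.
    rewrite -(opprK (br h x)) -(brC br_lie) memvN bI //.
    exact: rspace_sub_borel pQ xp.
  have /eqP := Iab _ _ hI hxI; rewrite hx brZr hx scalerA scaler_eq0.
  by rewrite (negPf x0) orbF mulf_eq0 orbb => /eqP.
have Phi0 p : p \in 0 :: Phi -> weight_val p h = 0.
  rewrite inE => /predU1P[->|/borel_weightsN/orP[/Q0//|/Q0]].
    exact: weight_val0.
  by rewrite weight_valN => /eqP; rewrite oppr_eq0 => /eqP.
have [X Xbasis XP] := weight_basis.
apply: (br_centerless br_lie br_simple); apply/lfunP => x; rewrite zero_lfunE.
rewrite (coord_basis (X := in_tuple X) Xbasis (memvf x)) linear_sum.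
rewrite big1 //= => i _.
have [|p pP /mem_rspace xp] := XP X`_i; first by rewrite mem_nth.
by rewrite brZr xp // Phi0 // scale0r scaler0.
Qed.

(** [S] collects the weights of the root spaces contained in [I]. Membership of
    one nonzero root vector suffices, as root spaces are lines. *)
Lemma abelian_ideal_weight_sum (I : {vspace L}) :
    abelian_ideals br bor I ->
  exists2 S, S \in abelian_ideal_weight_sets Q & I = weight_sum S.
Proof.
move=> [Iideal Iab]; have [Ib bI] := Iideal.
pose inI p := (rspace p <= I)%VS; pose S := [seq p <- Q | inI p].
have SQ : {subset S <= Q} by move=> p; rewrite mem_filter => /andP[].
have SI p x : p \in S -> x \in rspace p -> x \in I.
  by rewrite mem_filter => /andP[/subvP pI _] /pI.
have line p x : p \in Q -> x \in rspace p -> x != 0 -> x \in I -> p \in S.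
  move=> pQ xp x0 xI; rewrite mem_filter pQ andbT /inI.
  by rewrite (rspace_line (borel_weights_sub pQ) xp x0) -memvE.
exists S; last first.
  apply/eqP; rewrite eqEsubv; apply/andP; split; last first.
    by apply: subv_seq_sum => p; rewrite mem_filter => /andP[].
  apply/subvP => x xI; have [w wP xE] := mem_borel (subvP Ib x xI).
  have wI p : p \in 0 :: Q -> w p \in I.
    apply: rspace_components => //.
    - by move=> h u hH uI; apply: bI => //; apply: H_sub_borel.
    - rewrite cons_uniq borel_weights_uniq andbT.
      by apply: contra G2_zero_notin; apply: borel_weights_sub.
    - move=> q; rewrite inE => /predU1P[->|/borel_weights_sub qP] //.
      by rewrite inE qP orbT.
    - by rewrite big_cons -xE.
  have w0 : w 0 = 0.
    apply: (abelian_ideal_H Iideal Iab); first by rewrite wI ?mem_head.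
    by rewrite -rspace0.
  rewrite xE w0 add0r big_seq memv_suml // => p pQ.
  have [->|wp0] := eqVneq (w p) 0; first exact: mem0v.
  have pS : p \in S by apply: (line p (w p)) => //; rewrite wI // inE pQ orbT.
  exact: (subvP (seq_sum_sup _ pS)) (wP p).
rewrite mem_filter filter_subseqs andbT /abelian_ideal_weights.
have brS p q : p \in Q -> q \in S -> p + q \in Phi -> exists x y,
    [/\ x \in rspace p, y \in I, br x y \in rspace (p + q), br x y \in I
      & br x y != 0].
  move=> pQ qS pqP; have pP := borel_weights_sub pQ.
  have qP := borel_weights_sub (SQ q qS).
  have [[x xp x0] [y yq y0]] := (root_vector pP, root_vector qP).
  exists x, y; split; first exact: xp.
  - exact: SI qS yq.
  - exact: br_rspace.
  - by apply: bI; [apply: rspace_sub_borel pQ xp | apply: SI qS yq].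
  - exact: root_bracket_neq0 pP qP pqP xp yq x0 y0.
rewrite ifT; last first.
  apply/allP => p pS; apply/allP => q qS; apply/negP => pqP.
  have [x [y [xp yI _ _]]] := brS p q (SQ p pS) qS pqP.
  by rewrite Iab ?eqxx //; apply: SI pS xp.
apply/allP => p pQ; apply/allP => q qS; case: ifP => // pqP.
have [x [y [_ _ xyp xyI xy0]]] := brS p q pQ qS pqP.
exact: line (borel_weights_closed pQ (SQ q qS) pqP) xyp xy0 xyI.
Qed.

Lemma weight_sum_abelian_ideal S : S \in abelian_ideal_weight_sets Q ->
  abelian_ideals br bor (weight_sum S).
Proof.
rewrite mem_filter => /andP[]; rewrite /abelian_ideal_weights; case: ifP => //.
move=> /allP Sab /allP Sideal /mem_subseqs SQsub.
have SQ := mem_subseq SQsub; have uS := subseq_uniq SQsub borel_weights_uniq.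
have SP p x : p \in S -> x \in rspace p -> x \in weight_sum S.
  by move=> pS; apply/subvP/seq_sum_sup.
have br_sum (r s : seq weight) (w v : weight -> L) :
    br (\sum_(p <- r) w p) (\sum_(q <- s) v q) =
    \sum_(p <- r) \sum_(q <- s) br (w p) (v q).
  rewrite (linear_sum br) sum_lfunE; apply: eq_bigr => p _.
  by rewrite linear_sum.
split; first split.
- apply: subv_seq_sum => p /SQ pQ; apply/subvP => x.
  exact: rspace_sub_borel.
- move=> x y /mem_borel[w wP ->] /(mem_seq_sum uS)[v vP ->].
  rewrite brDl br_sum memvD // ?linear_sum /=.
    rewrite big_seq memv_suml // => q qS; apply: (SP q) => //.
    by have := br_rspace (wP 0) (vP q); rewrite add0r.
  rewrite big_seq memv_suml // => p pQ; rewrite big_seq memv_suml // => q qS.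
  have [pqP|pqN] := boolP (p + q \in Phi).
    apply: (SP (p + q)); last exact: br_rspace.
    by have := allP (Sideal p pQ) q qS; rewrite pqP.
  rewrite (br_rspace_eq0 _ (wP p) (vP q)) ?mem0v //.
  by apply: contra pqN; apply: borel_weights_add pQ (SQ q qS).
move=> x y /(mem_seq_sum uS)[w wP ->] /(mem_seq_sum uS)[v vP ->].
rewrite br_sum big_seq big1 // => p pS; rewrite big_seq big1 // => q qS.
apply: (br_rspace_eq0 _ (wP p) (vP q)).
have := allP (Sab p pS) q qS; apply: contra.
exact: borel_weights_add (SQ p pS) (SQ q qS).
Qed.

Lemma dim_abelian_ideal S : S \in abelian_ideal_weight_sets Q ->
  \dim (weight_sum S) = size S.
Proof.
rewrite mem_filter => /andP[_ /mem_subseqs SQ].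
rewrite dim_weight_sum ?(subseq_uniq SQ borel_weights_uniq) // => p.
by move/(mem_subseq SQ)/borel_weights_sub.
Qed.

Lemma abelian_ideal_dim_lt (I : {vspace L}) :
  abelian_ideals br bor I -> (\dim I < 4)%N.
Proof.
case/abelian_ideal_weight_sum => S SP ->; rewrite dim_abelian_ideal //.
by have := map_f size SP; rewrite (perm_mem borel_weights_size) mem_iota.
Qed.

Lemma abelian_ideal_dim_inj (I J : {vspace L}) :
  abelian_ideals br bor I -> abelian_ideals br bor J -> \dim I = \dim J ->
  I = J.
Proof.
case/abelian_ideal_weight_sum => S SP ->.
case/abelian_ideal_weight_sum => T TP ->.
rewrite !dim_abelian_ideal // => ST; congr weight_sum.
have /(uniqP 0%N) size_inj : uniq (map size (abelian_ideal_weight_sets Q)).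
  by rewrite (perm_uniq borel_weights_size) iota_uniq.
rewrite -(nth_index [::] SP) -(nth_index [::] TP); congr nth.
apply: size_inj; rewrite ?inE ?size_map ?index_mem //.
by rewrite !(nth_map [::]) ?index_mem // !nth_index.
Qed.

Lemma abelian_ideal_exists m : (m < 4)%N ->
  exists2 I : {vspace L}, abelian_ideals br bor I & \dim I = m.
Proof.
move=> m4; have : m \in map size (abelian_ideal_weight_sets Q).
  by rewrite (perm_mem borel_weights_size) mem_iota.
case/mapP => S SP ->; exists (weight_sum S).
  exact: weight_sum_abelian_ideal.
exact: dim_abelian_ideal.
Qed.

End Borel.
End RootSpaces.

Theorem mainTheorem5 (R : realType) (L : vectType (complex R))
  (br : 'Hom(L, 'End(L))) (H b : {vspace L})
  (L_lie : is_lie_bracket br) (L_simple : lie_simple br)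
  (H_cartan : cartan_subalgebra br H)
  (L_G2 : root_system_of_type_G2 br H)
  (b_borel : borel_subalgebra br H b) :
  [/\ [/\ abelian_ideals_dim br b 0 #= `I_1, abelian_ideals_dim br b 1 #= `I_1,
          abelian_ideals_dim br b 2 #= `I_1 & abelian_ideals_dim br b 3 #= `I_1],
      forall m : nat, (4 <= m)%N -> abelian_ideals_dim br b m #= `I_0
    & abelian_ideals br b #= `I_4].
Proof.
have [u [v [uv_free uv_G2]]] := L_G2; have [P Ppos bE] := b_borel.
have dim_lt I := @abelian_ideal_dim_lt _ _ _ L_lie L_simple _ H_cartan _ _
  uv_free uv_G2 _ _ Ppos bE I.
have dim_inj I J := @abelian_ideal_dim_inj _ _ _ L_lie L_simple _ H_cartan _ _
  uv_free uv_G2 _ _ Ppos bE I J.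
have dim_ex m := @abelian_ideal_exists _ _ _ L_lie L_simple _ H_cartan _ _
  uv_free uv_G2 _ _ Ppos bE m.
have card1 m : (m < 4)%N -> abelian_ideals_dim br b m #= `I_1.
  move=> /dim_ex[I Iab Im].
  rewrite (_ : abelian_ideals_dim br b m = [set I]%classic) ?card_set1 //.
  apply/seteqP; split=> [J [Jab Jm]|_ ->//].
  by apply: dim_inj; rewrite // Jm Im.
split=> [|m m4|]; first by split; apply: card1.
  rewrite II0 card_eq0; apply/eqP/seteqP; split=> // I [/dim_lt + Im].
  by rewrite Im ltnNge m4.
have dim_img : (@dimv _ L @` abelian_ideals br b)%classic = `I_4.
  apply/seteqP; split=> [_ [I Iab <-]|m /dim_ex[I Iab Im]]; first exact: dim_lt.
  by exists I.
rewrite -dim_img card_eq_sym; apply: inj_card_eq => I J.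
by rewrite !inE => Iab Jab; apply: dim_inj.
Qed.
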